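(* Let $\mathcal I$ be a strictly proper ideal of subsets of $\Omega$. There exists $P\in\Delta_{BD}$ such that $P(E)=0$ for every $E\in\mathcal I\cap\Sigma$.
   Context: Let $\Omega=\{0,1\}^{\mathbb N}$ (paths); for $\omega\in\Omega$, $t\ge0$, $\omega^t$ is the cylinder of paths agreeing with $\omega$ in the first $t$ coordinates. $\Sigma$ is a fixed $\sigma$-algebra on $\Omega$ containing all cylinders, and $\mathbb P$ the set of finitely additive probabilities on $(\Omega,\Sigma)$. $P\in\mathbb P$ is strongly nonatomic if for every $E\in\Sigma$ and $\alpha\in[0,1]$ there is $F\in\Sigma$, $F\subseteq E$, with $P(F)=\alpha P(E)$. For $R\in\mathbb P$ and a cylinder with $R(\omega^t)>0$, $R(E\mid\omega^t)=R(E\cap\omega^t)/R(\omega^t)$. $P$ merges with $Q$ if for every $\varepsilon>0$, $Q(\{\omega:\sup_{E\in\Sigma}|P(E\mid\omega^t)-Q(E\mid\omega^t)|>\varepsilon\})\to0$ as $t\to\infty$ (cylinders with $Q(\omega^t)>0=P(\omega^t)$ counted in the set). $Q\ll P$ means: for every sequence $(E_n)$ in $\Sigma$, $P(E_n)\to0$ implies $Q(E_n)\to0$. $P$ has the Blackwell–Dubins property if it merges with every $Q\in\mathbb P$ with $Q\ll P$; $\Delta_{BD}$ is the set of strongly nonatomic $P\in\mathbb P$ with this property. A collection $\mathcal I$ of subsets of $\Omega$ is a strictly proper ideal if (1) $S\in\mathcal I$, $R\subseteq S$ imply $R\in\mathcal I$; (2) $R,S\in\mathcal I$ imply $R\cup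 S\in\mathcal I$; (3) no cylinder belongs to $\mathcal I$. *)

(* Defs.v *)
From Stdlib Require Import Reals.
Open Scope R_scope.

Definition Omega : Type := nat -> bool.
Definition set := Omega -> Prop.

Definition setT : set := fun _ => True.
Definition setI (A B : set) : set := fun w => A w /\ B w.
Definition setU (A B : set) : set := fun w => A w \/ B w.
Definition setC (A : set) : set := fun w => ~ A w.
Definition subset (A B : set) : Prop := forall w, A w -> B w.
Definition disjoint (A B : set) : Prop := forall w, A w -> B w -> False.

Definition cyl (w : Omega) (t : nat) : set :=
  fun v => forall i, (i < t)%nat -> v i = w i.

Definition is_sigma_algebra (Sigma : set -> Prop) : Prop :=
  Sigma setT /\
  (forall A, Sigma A -> Sigma (setC A)) /\
  (forall A : nat -> set, (forall n, Sigma (A n)) ->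
      Sigma (fun w => exists n, A n w)).

Definition contains_cylinders (Sigma : set -> Prop) : Prop :=
  forall w t, Sigma (cyl w t).

(* finitely additive probability on (Omega, Sigma); values off Sigma are irrelevant *)
Definition is_FAP (Sigma : set -> Prop) (P : set -> R) : Prop :=
  (forall E, Sigma E -> 0 <= P E) /\
  P setT = 1 /\
  (forall E F, Sigma E -> Sigma F -> disjoint E F -> P (setU E F) = P E + P F).

Definition strongly_nonatomic (Sigma : set -> Prop) (P : set -> R) : Prop :=
  forall E alpha, Sigma E -> 0 <= alpha <= 1 ->
    exists F, Sigma F /\ subset F E /\ P F = alpha * P E.

(* R(E | omega^t), meaningful when R(omega^t) > 0 *)
Definition cond (P : set -> R) (E : set) (w : Omega) (t : nat) : R :=
  P (setI E (cyl w t)) / P (cyl w t).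

(* The set of paths where the conditionals at time t differ by more than eps
   (sup_E |..| > eps unfolded as: some E in Sigma with |..| > eps), together
   with the cylinders with Q(omega^t) > 0 = P(omega^t). *)
Definition bad_set (Sigma : set -> Prop) (P Q : set -> R) (eps : R) (t : nat) : set :=
  fun w => 0 < Q (cyl w t) /\
    (P (cyl w t) = 0 \/
     (0 < P (cyl w t) /\
      exists E, Sigma E /\ Rabs (cond P E w t - cond Q E w t) > eps)).

Definition merges (Sigma : set -> Prop) (P Q : set -> R) : Prop :=
  forall eps, eps > 0 -> Un_cv (fun t => Q (bad_set Sigma P Q eps t)) 0.

Definition abs_cont (Sigma : set -> Prop) (Q P : set -> R) : Prop :=
  forall E : nat -> set, (forall n, Sigma (E n)) ->
    Un_cv (fun n => P (E n)) 0 -> Un_cv (fun n => Q (E n)) 0.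

Definition Blackwell_Dubins (Sigma : set -> Prop) (P : set -> R) : Prop :=
  forall Q, is_FAP Sigma Q -> abs_cont Sigma Q P -> merges Sigma P Q.

Definition in_Delta_BD (Sigma : set -> Prop) (P : set -> R) : Prop :=
  is_FAP Sigma P /\ strongly_nonatomic Sigma P /\ Blackwell_Dubins Sigma P.

Definition strictly_proper_ideal (I : set -> Prop) : Prop :=
  (forall S R0, I S -> subset R0 S -> I R0) /\
  (forall R0 S, I R0 -> I S -> I (setU R0 S)) /\
  (forall w t, ~ I (cyl w t)).

(* Main.v *)
(** Take the fair-coin measure on the algebra of clopen sets modulo the ideal.
    A one-set extension of a finitely additive probability that gives the new
    set its outer content keeps the old algebra dense, so by Zorn's lemma there
    is an extension [P] to all sets in which every set is [P]-approximated by
    clopen ones.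

    Given such a [P] and [Q << P], consider the potential
    sum_C P(C) Q(C) / (P(C) + Q(C)) over the cylinders [C] of length [t].
    It decreases in [t] because the kernel xy/(x+y) is superadditive.  Splitting
    each cylinder further along an event [E] lowers it, for large [t], by an
    amount that tends to 0 uniformly in [E], since [E] is almost clopen.  But by
    the identity for the superadditivity gap, the drop on a cylinder controls
    |P(E | C) - Q(E | C)|; applying this to an event glued from one witness per
    bad cylinder gives merging. *)
Require Import Defs.
From Stdlib Require Import Reals Lra Lia Arith.
From Stdlib Require Import Classical ClassicalEpsilon FunctionalExtensionality PropExtensionality.
From mathcomp Require classical_sets.
Open Scope R_scope.
Set Bullet Behavior "Strict Subproofs".

(** * Set operations and pointwise Boolean reasoning *)

Definition set0 : set := fun _ => False.
Definition setD (A B : set) : set := fun w => A w /\ ~ B w.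
Definition symdiff (A B : set) : set := setU (setD A B) (setD B A).

Lemma set_ext (A B : set) : (forall w, A w <-> B w) -> A = B.
Proof.
  intro H. apply functional_extensionality; intro w.
  apply propositional_extensionality, H.
Qed.

(** Since [tauto] is intuitionistic, excluded middle is supplied at [w] for every set named in the
    context. Compound sets such as cylinders get no such case split, hence the abbreviations
    [set (C := ...)] before several calls. *)
Ltac at_point w :=
  repeat match goal with
  | H : subset _ _ |- _ => specialize (H w)
  | H : disjoint _ _ |- _ => specialize (H w)
  end;
  repeat match goal with
  | X : set |- _ =>
      lazymatch goal with
      | _ : X w \/ ~ X w |- _ => fail
      | _ => pose proof (classic (X w))
      end
  end;
  unfold symdiff, setD, setI, setU, setC, setT, set0, subset, disjoint in *;
  tauto.

Ltac set_tac :=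
  match goal with
  | |- _ = _ => apply set_ext; let w := fresh "w" in intro w; at_point w
  | |- subset _ _ => let w := fresh "w" in intro w; at_point w
  | |- disjoint _ _ => let w := fresh "w" in intro w; at_point w
  end.

(** * Algebras of sets and finitely additive probabilities *)

Definition is_algebra (B : set -> Prop) : Prop :=
  B setT /\
  (forall A, B A -> B (setC A)) /\
  (forall A1 A2, B A1 -> B A2 -> B (setU A1 A2)).

Lemma sigma_algebra_algebra (Sigma : set -> Prop) :
  is_sigma_algebra Sigma -> is_algebra Sigma.
Proof.
  intros (HT & HC & HU); split; [|split]; auto.
  intros A1 A2 H1 H2.
  replace (setU A1 A2)
    with (fun w => exists n, (match n with O => A1 | _ => A2 end) w).
  - apply HU. intros [|n]; assumption.
  - apply set_ext; intro w; split.
    + intros [[|n] H]; [left | right]; assumption.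
    + intros [H | H]; [exists O | exists 1%nat]; assumption.
Qed.

Lemma all_sets_algebra : is_algebra (fun _ => True).
Proof. repeat split. Qed.

Section Algebra.

Context (B : set -> Prop) (HB : is_algebra B).

Lemma algT : B setT.
Proof. apply HB. Qed.

Lemma algC A : B A -> B (setC A).
Proof. apply HB. Qed.

Lemma algU A1 A2 : B A1 -> B A2 -> B (setU A1 A2).
Proof. apply HB. Qed.

Lemma alg0 : B set0.
Proof. replace set0 with (setC setT) by set_tac. apply algC, algT. Qed.

Lemma algI A1 A2 : B A1 -> B A2 -> B (setI A1 A2).
Proof.
  intros. replace (setI A1 A2) with (setC (setU (setC A1) (setC A2))) by set_tac.
  auto using algC, algU.
Qed.

Lemma algD A1 A2 : B A1 -> B A2 -> B (setD A1 A2).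
Proof.
  intros. replace (setD A1 A2) with (setI A1 (setC A2)) by set_tac.
  auto using algC, algI.
Qed.

Lemma alg_symdiff A1 A2 : B A1 -> B A2 -> B (symdiff A1 A2).
Proof. unfold symdiff. auto using algU, algD. Qed.

Context (mu : set -> R) (Hmu : is_FAP B mu).

Lemma fap_ge0 A : B A -> 0 <= mu A.
Proof. apply Hmu. Qed.

Lemma fapT : mu setT = 1.
Proof. apply Hmu. Qed.

Lemma fapU A1 A2 : B A1 -> B A2 -> disjoint A1 A2 -> mu (setU A1 A2) = mu A1 + mu A2.
Proof. apply Hmu. Qed.

Lemma fap0 : mu set0 = 0.
Proof.
  assert (H : mu (setU set0 set0) = mu set0 + mu set0).
  { apply fapU; try apply alg0. set_tac. }
  replace (setU set0 set0) with set0 in H by set_tac. lra.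
Qed.

Lemma fap_split X Y : B X -> B Y -> mu X = mu (setI X Y) + mu (setD X Y).
Proof.
  intros. rewrite <- fapU; auto using algI, algD.
  - f_equal. set_tac.
  - set_tac.
Qed.

Lemma fap_le X Y : B X -> B Y -> subset X Y -> mu X <= mu Y.
Proof.
  intros HX HY S. rewrite (fap_split Y X) by auto.
  replace (setI Y X) with X by set_tac.
  pose proof (fap_ge0 (setD Y X)). specialize (H (algD _ _ HY HX)). lra.
Qed.

Lemma fap_leU X Y : B X -> B Y -> mu (setU X Y) <= mu X + mu Y.
Proof.
  intros HX HY. replace (setU X Y) with (setU X (setD Y X)) by set_tac.
  rewrite fapU; auto using algD; [|set_tac].
  apply Rplus_le_compat_l, fap_le; auto using algD. set_tac.
Qed.

Lemma fapC X : B X -> mu (setC X) = 1 - mu X.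
Proof.
  intro HX. rewrite <- fapT, (fap_split setT X) by auto using algT.
  replace (setI setT X) with X by set_tac.
  replace (setD setT X) with (setC X) by set_tac. lra.
Qed.

Lemma fap_symdiff_trans X Y Z : B X -> B Y -> B Z ->
  mu (symdiff X Z) <= mu (symdiff X Y) + mu (symdiff Y Z).
Proof.
  intros. eapply Rle_trans; [|apply fap_leU]; auto using alg_symdiff.
  apply fap_le; auto using alg_symdiff, algU. set_tac.
Qed.

(** * Outer content of a finitely additive probability *)

Definition is_outer (m : set -> R) : Prop :=
  forall X, (forall A, B A -> subset X A -> m X <= mu A) /\
    (forall eps, eps > 0 -> exists A, B A /\ subset X A /\ mu A < m X + eps).

Lemma outer_exists : exists m, is_outer m.
Proof.
  apply (choice (fun X r => (forall A, B A -> subset X A -> r <= mu A) /\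
    (forall eps, eps > 0 -> exists A, B A /\ subset X A /\ mu A < r + eps))).
  intro X.
  (* Completeness provides suprema, so the infimum of [mu A] over covers is obtained as minus the
     supremum of [- mu A]. *)
  destruct (completeness (fun r => exists A, B A /\ subset X A /\ r = - mu A))
    as [s [Hub Hlub]].
  - exists 0. intros r (A & HA & _ & ->). pose proof (fap_ge0 A HA). lra.
  - exists (- mu setT), setT. repeat split; [apply algT].
  - exists (- s). split.
    + intros A HA S. assert (- mu A <= s) by (apply Hub; eauto). lra.
    + intros eps Heps. apply NNPP; intro N.
      assert (s <= s - eps); [|lra].
      apply Hlub. intros r (A & HA & S & ->).
      destruct (Rlt_le_dec (mu A) (- s + eps)); [|lra].
      exfalso; apply N; eauto.
Qed.

Context (m : set -> R) (Hm : is_outer m).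

Lemma outer_eq A : B A -> m A = mu A.
Proof.
  intro HA. apply Rle_antisym.
  - apply (Hm A); auto. set_tac.
  - apply le_epsilon; intros eps Heps.
    destruct (proj2 (Hm A) eps Heps) as (A' & HA' & S & L).
    pose proof (fap_le A A' HA HA' S). lra.
Qed.

Lemma outer_ge0 X : 0 <= m X.
Proof.
  apply le_epsilon; intros eps Heps.
  destruct (proj2 (Hm X) eps Heps) as (A & HA & S & L).
  pose proof (fap_ge0 A HA). lra.
Qed.

Lemma outer_le1 X : m X <= 1.
Proof. rewrite <- fapT. apply (Hm X); [apply algT | set_tac]. Qed.

(** Covers of the two pieces unite to a cover of [X], and a cover of [X] is cut by [A] into covers
    of the two pieces. *)
Lemma caratheodory X A : B A -> m X = m (setI X A) + m (setD X A).
Proof.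
  intro HA. apply Rle_antisym; apply le_epsilon; intros eps Heps.
  - destruct (proj2 (Hm (setI X A)) (eps / 2) ltac:(lra)) as (A1 & H1 & S1 & L1).
    destruct (proj2 (Hm (setD X A)) (eps / 2) ltac:(lra)) as (A2 & H2 & S2 & L2).
    assert (m X <= mu (setU A1 A2)).
    { apply (Hm X); auto using algU. set_tac. }
    pose proof (fap_leU A1 A2 H1 H2). lra.
  - destruct (proj2 (Hm X) eps Heps) as (A' & H' & S' & L').
    assert (m (setI X A) <= mu (setI A' A)).
    { apply Hm; auto using algI. set_tac. }
    assert (m (setD X A) <= mu (setD A' A)).
    { apply Hm; auto using algD. set_tac. }
    pose proof (fap_split A' A H' HA). lra.
Qed.

(** * Extension by one set *)

Context (E : set).

(** The algebra generated by [B] and [E]. *)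
Definition adjoin (S : set) : Prop :=
  exists B1 B2, B B1 /\ B B2 /\ S = setU (setI B1 E) (setD B2 E).

(* The outer content of [S ∩ E] plus the inner content of [S \ E]. *)
Definition adjoin_content (S : set) : R :=
  m (setI S E) + (1 - m (setU (setC S) E)).

Lemma adjoin_algebra : is_algebra adjoin.
Proof.
  split; [|split].
  - exists setT, setT. repeat split; auto using algT. set_tac.
  - intros S (B1 & B2 & H1 & H2 & ->).
    exists (setC B1), (setC B2). repeat split; auto using algC. set_tac.
  - intros S1 S2 (B1 & B2 & H1 & H2 & ->) (C1 & C2 & H3 & H4 & ->).
    exists (setU B1 C1), (setU B2 C2). repeat split; auto using algU. set_tac.
Qed.

Lemma adjoin_incl A : B A -> adjoin A.
Proof. intro HA. exists A, A. repeat split; auto. set_tac. Qed.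

Lemma adjoin_mem : adjoin E.
Proof. exists setT, set0. repeat split; auto using algT, alg0. set_tac. Qed.

(** Cutting [setU (setC A) E] along [A] leaves [setI A E] and [setC A], so the outer content of
    [setI A E] cancels. *)
Lemma adjoin_content_eq A : B A -> adjoin_content A = mu A.
Proof.
  intro HA. unfold adjoin_content.
  rewrite (caratheodory (setU (setC A) E) A HA).
  replace (setI (setU (setC A) E) A) with (setI A E) by set_tac.
  replace (setD (setU (setC A) E) A) with (setC A) by set_tac.
  rewrite (outer_eq (setC A)), fapC by auto using algC. lra.
Qed.

Lemma adjoin_fap : is_FAP adjoin adjoin_content.
Proof.
  split; [|split].
  - intros S _. unfold adjoin_content.
    pose proof (outer_ge0 (setI S E)).
    pose proof (outer_le1 (setU (setC S) E)). lra.
  - rewrite adjoin_content_eq by apply algT. apply fapT.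
  (* Members of [B] separate the disjoint sets [S1] and [S2]: [B1] does so inside [E] and [B2]
     outside, so cutting along them gives additivity. *)
  - intros S1 S2 (B1 & B2 & H1 & H2 & e) _ D. unfold adjoin_content.
    rewrite (caratheodory (setI (setU S1 S2) E) B1 H1).
    rewrite (caratheodory (setU (setC S1) E) B2 H2).
    rewrite (caratheodory (setU (setC (setU S1 S2)) E) B2 H2).
    rewrite (caratheodory (setU (setC S2) E) B2 H2).
    replace (setI (setI (setU S1 S2) E) B1) with (setI S1 E) by (subst S1; set_tac).
    replace (setD (setI (setU S1 S2) E) B1) with (setI S2 E) by (subst S1; set_tac).
    replace (setI (setU (setC (setU S1 S2)) E) B2)
      with (setI (setU (setC S1) E) B2) by (subst S1; set_tac).
    replace (setD (setU (setC S1) E) B2) with (setC B2) by (subst S1; set_tac).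
    replace (setI (setU (setC S2) E) B2) with B2 by (subst S1; set_tac).
    replace (setD (setU (setC (setU S1 S2)) E) B2)
      with (setD (setU (setC S2) E) B2) by (subst S1; set_tac).
    rewrite (outer_eq B2), (outer_eq (setC B2)), fapC by auto using algC. lra.
Qed.

(* Since [E] carries its outer content, any [A] in [B] that nearly realises
   that outer content satisfies [content (A \ E) < eps]. *)
Lemma adjoin_dense S eps : adjoin S -> eps > 0 ->
  exists A, B A /\ adjoin_content (symdiff S A) < eps.
Proof.
  intros (B1 & B2 & H1 & H2 & ->) Heps.
  destruct (proj2 (Hm E) eps Heps) as (A & HA & SA & LA).
  (* The cover [A] takes the place of [E] in the expression for [S]. The two sets agree on [E] and
     off [A], so they differ only within [setD A E]. *)
  exists (setU (setI B1 A) (setD B2 A)).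
  split; [auto using algU, algI, algD|].
  assert (L : adjoin_content (setD A E) < eps).
  { unfold adjoin_content.
    rewrite (caratheodory (setU (setC (setD A E)) E) A HA).
    replace (setI (setU (setC (setD A E)) E) A) with E by set_tac.
    replace (setD (setU (setC (setD A E)) E) A) with (setC A) by set_tac.
    replace (setI (setD A E) E) with set0 by set_tac.
    rewrite (outer_eq set0), (outer_eq (setC A)), fapC, fap0 by auto using algC, alg0.
    lra. }
  apply Rle_lt_trans with (2 := L).
  assert (F := adjoin_fap). assert (G := adjoin_algebra).
  destruct F as (F0 & F1 & F2).
  assert (Hle : forall X Y, adjoin X -> adjoin Y -> subset X Y ->
    adjoin_content X <= adjoin_content Y).
  { intros X Y HX HY SXY.
    assert (HD : adjoin (setD Y X)).
    { replace (setD Y X) with (setC (setU (setC Y) X)) by set_tac.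
      apply G, G; auto. apply G; auto. }
    replace Y with (setU X (setD Y X)) by set_tac.
    rewrite F2; auto; [|set_tac]. specialize (F0 _ HD). lra. }
  apply Hle; [| |set_tac].
  - exists (symdiff B1 (setU (setI B1 A) (setD B2 A))),
           (symdiff B2 (setU (setI B1 A) (setD B2 A))).
    repeat split; auto using alg_symdiff, algU, algI, algD. set_tac.
  - exists set0, A. repeat split; auto using alg0. set_tac.
Qed.

End Algebra.

(** * Extension to all sets by Zorn's lemma, keeping the initial algebra dense *)

Section DenseExtension.

Context (B0 : set -> Prop) (HB0 : is_algebra B0).
Context (mu0 : set -> R) (Hmu0 : is_FAP B0 mu0).

Definition extends (B B' : set -> Prop) (mu mu' : set -> R) : Prop :=
  forall E, B E -> B' E /\ mu' E = mu E.

(** Approximants always come from the initial algebra [B0], so that density passes to unions of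
    chains. *)
Definition dense_ext (B : set -> Prop) (mu : set -> R) : Prop :=
  is_algebra B /\ is_FAP B mu /\ extends B0 B mu0 mu /\
  (forall E eps, B E -> eps > 0 -> exists F, B0 F /\ mu (symdiff E F) < eps).

Lemma dense_ext_refl : dense_ext B0 mu0.
Proof.
  split; [|split; [|split]]; auto.
  - split; auto.
  - intros E eps HE Heps. exists E. split; auto.
    replace (symdiff E E) with set0 by set_tac.
    rewrite (fap0 B0 HB0 mu0 Hmu0). lra.
Qed.

(** [adjoin_dense] approximates a new set within [B], and density of [B0] in [B] approximates that
    set in turn; the triangle inequality for [symdiff] combines the two. *)
Lemma dense_ext_step (B : set -> Prop) (mu : set -> R) (E : set) :
  dense_ext B mu ->
  exists B' mu', dense_ext B' mu' /\ extends B B' mu mu' /\ B' E.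
Proof.
  intros (HB & Hmu & He & Hd).
  destruct (outer_exists B HB mu Hmu) as [m Hm].
  exists (adjoin B E), (adjoin_content m E).
  assert (HA := adjoin_algebra B HB E).
  assert (HF := adjoin_fap B HB mu Hmu m Hm E).
  assert (Hx : extends B (adjoin B E) mu (adjoin_content m E)).
  { intros A HA'. split; [apply adjoin_incl | apply (adjoin_content_eq B HB mu Hmu m Hm)];
      assumption. }
  split; [|split]; auto using adjoin_mem.
  split; [|split; [|split]]; auto.
  - intros A HA0. destruct (He A HA0) as [H1 H2].
    destruct (Hx A H1) as [H3 H4]. split; auto. congruence.
  - intros S eps HS Heps.
    destruct (adjoin_dense B HB mu Hmu m Hm E S (eps / 2) HS ltac:(lra)) as (A & H1 & L1).
    destruct (Hd A (eps / 2) H1 ltac:(lra)) as (F & H2 & L2).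
    exists F. split; auto.
    assert (H3 : B F) by apply (He F H2).
    pose proof (fap_symdiff_trans _ HA _ HF S A F HS
      (proj1 (Hx A H1)) (proj1 (Hx F H3))).
    rewrite (proj2 (Hx (symdiff A F) (alg_symdiff B HB A F H1 H3))) in H. lra.
Qed.

Definition pair_ext (x y : (set -> Prop) * (set -> R)) : Prop :=
  extends (fst x) (fst y) (snd x) (snd y).

Lemma dense_ext_chain (K : (set -> Prop) * (set -> R) -> Prop) :
  K (B0, mu0) ->
  (forall x, K x -> dense_ext (fst x) (snd x)) ->
  (forall x y, K x -> K y -> pair_ext x y \/ pair_ext y x) ->
  exists z, dense_ext (fst z) (snd z) /\ forall x, K x -> pair_ext x z.
Proof.
  intros K0 Hg Ht.
  (* Members of the chain agree wherever both are defined, so a common value exists; off the union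
     it is 0. *)
  destruct (choice (fun E r => forall x, K x -> fst x E -> r = snd x E)) as [mu Hmu].
  { intro E. destruct (classic (exists x, K x /\ fst x E)) as [(x & Kx & Hx)|N].
    - exists (snd x E). intros y Ky Hy.
      destruct (Ht x y Kx Ky) as [L|L]; [symmetry|]; apply L; assumption.
    - exists 0. intros x Kx Hx. exfalso; eauto. }
  set (B := fun E => exists x, K x /\ fst x E).
  assert (Hx : forall x, K x -> pair_ext x (B, mu)).
  { intros x Kx E HE. split; simpl; [exists x; auto | auto]. }
  exists (B, mu); split; auto.
  (* Two sets of the union already lie in one member of the chain, which reduces the algebra and
     additivity laws to that member. *)
  assert (H2 : forall E F, B E -> B F -> exists x, K x /\ fst x E /\ fst x F).
  { intros E F (x & Kx & HE) (y & Ky & HF).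
    destruct (Ht x y Kx Ky) as [L|L]; [exists y | exists x]; repeat split; auto; apply L; auto. }
  split; [|split; [|split]]; simpl.
  - split; [|split].
    + exists (B0, mu0). split; auto. apply HB0.
    + intros A (x & Kx & HA). exists x; split; auto.
      apply (algC _ (proj1 (Hg x Kx))), HA.
    + intros A1 A2 HA1 HA2. destruct (H2 A1 A2 HA1 HA2) as (x & Kx & H3 & H4).
      exists x; split; auto. apply (algU _ (proj1 (Hg x Kx))); auto.
  - split; [|split].
    + intros E (x & Kx & HE). rewrite (Hmu E x Kx HE).
      apply (fap_ge0 _ _ (proj1 (proj2 (Hg x Kx)))), HE.
    + rewrite (Hmu setT (B0, mu0) K0 (proj1 HB0)). apply Hmu0.
    + intros E F HE HF D. destruct (H2 E F HE HF) as (x & Kx & H3 & H4).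
      destruct (Hg x Kx) as ((_ & _ & HU) & (_ & _ & Ha) & _).
      rewrite (Hmu E x), (Hmu F x), (Hmu (setU E F) x); auto.
  - apply (Hx _ K0).
  - intros E eps (x & Kx & HE) Heps. destruct (Hg x Kx) as (Ha & _ & He & Hd).
    destruct (Hd E eps HE Heps) as (F & HF & L). exists F; split; auto.
    rewrite (Hmu _ x Kx); auto. apply alg_symdiff; auto. apply He; auto.
Qed.

Theorem dense_extension : exists P,
  is_FAP (fun _ => True) P /\ (forall E, B0 E -> P E = mu0 E) /\
  (forall E eps, eps > 0 -> exists F, B0 F /\ P (symdiff E F) < eps).
Proof.
  set (T := {x : (set -> Prop) * (set -> R) | dense_ext (fst x) (snd x)}).
  set (x0 := exist _ (B0, mu0) dense_ext_refl : T).
  (* [pair_ext] ignores values off the algebra and so is not antisymmetric; this calls for Zorn's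
     lemma for preorders, which takes a boolean relation. *)
  set (le := fun x y : T =>
    if excluded_middle_informative (pair_ext (proj1_sig x) (proj1_sig y))
    then true else false).
  assert (Hle : forall x y, is_true (le x y) <-> pair_ext (proj1_sig x) (proj1_sig y)).
  { intros x y. unfold le.
    destruct excluded_middle_informative; split; intro; auto; discriminate. }
  destruct (@classical_sets.ZL_preorder T x0 le) as [[[B mu] Hz] Hmax].
  - intro x. apply Hle. intros E HE; auto.
  - intros r s t H1 H2. apply Hle. apply Hle in H1. apply Hle in H2.
    intros E HE. destruct (H1 E HE) as [H3 e3]. destruct (H2 E H3) as [H4 e4].
    split; auto. congruence.
  - intros A HA.
    (* Adding the initial pair to the chain also covers the empty chain. *)
    destruct (dense_ext_chain (fun x => x = (B0, mu0) \/
      exists s, A s /\ proj1_sig s = x)) as (z & Hz & Hub).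
    + left; auto.
    + intros x [-> | (s & _ & <-)]; [exact dense_ext_refl | exact (proj2_sig s)].
    + intros x y Hx Hy.
      destruct Hx as [-> | (s & As & <-)]; destruct Hy as [-> | (s' & As' & <-)].
      * left. intros E HE; auto.
      * left. apply (proj2_sig s').
      * right. apply (proj2_sig s).
      * destruct (HA s s' As As') as [L|L]; apply Hle in L; auto.
    + exists (exist _ z Hz). intros s As. apply Hle. simpl. apply Hub. eauto.
  (* By maximality, the extension that adjoins [E] is extended by [B] itself, so [E] was already in
     [B]. *)
  - assert (all : forall E, B E).
    { intro E. destruct (dense_ext_step B mu E Hz) as (B' & mu' & Hg & Hx & HE).
      specialize (Hmax (exist _ (B', mu') Hg)).
      rewrite !Hle in Hmax. apply (Hmax Hx E HE). }
    pose proof Hz as (_ & (F0 & F1 & F2) & He & Hd).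
    simpl in *. exists mu. split; [|split]; auto.
    + split; [|split]; auto.
    + intros E HE. apply He, HE.
Qed.

End DenseExtension.

(** * Cylinders and events decided in finite time *)

Definition upd (w : Omega) (t : nat) (b : bool) : Omega :=
  fun i => if Nat.eq_dec i t then b else w i.

Definition zeros : Omega := fun _ => false.

(** A canonical representative of [cyl w t]: all paths of that cylinder have the same truncation. *)
Definition trunc (w : Omega) (t : nat) : Omega :=
  fun i => if lt_dec i t then w i else false.

(** As [t] varies, these are exactly the clopen sets. *)
Definition dep (t : nat) (F : set) : Prop :=
  forall v w, cyl w t v -> F v -> F w.

(* Sum of [f] over the 2^t paths that vanish from time [t] on, which represent
   the cylinders of length [t]. *)
Fixpoint sumw (t : nat) (f : Omega -> R) : R :=
  match t with
  | O => f zeros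
  | S t => sumw t (fun w => f (upd w t false) + f (upd w t true))
  end.

Lemma sumw_ext t f g : (forall w, f w = g w) -> sumw t f = sumw t g.
Proof. intro H. f_equal. apply functional_extensionality, H. Qed.

Lemma sumw_le t : forall f g, (forall w, f w <= g w) -> sumw t f <= sumw t g.
Proof.
  induction t; simpl; intros f g H; auto.
  apply IHt. intro w. apply Rplus_le_compat; auto.
Qed.

Lemma sumw_add t : forall f g, sumw t (fun w => f w + g w) = sumw t f + sumw t g.
Proof.
  induction t; simpl; intros f g; auto.
  rewrite <- IHt. apply sumw_ext. intro; ring.
Qed.

Lemma sumw_scal t : forall c f, sumw t (fun w => c * f w) = c * sumw t f.
Proof.
  induction t; simpl; intros c f; auto.
  rewrite <- IHt. apply sumw_ext. intro; ring.
Qed.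

Lemma cyl_refl w t : cyl w t w.
Proof. intros i _; reflexivity. Qed.

Lemma cyl_sym v w t : cyl w t v -> cyl v t w.
Proof. intros H i Hi. symmetry; auto. Qed.

Lemma cyl_trans u v w t : cyl w t v -> cyl v t u -> cyl w t u.
Proof. intros H1 H2 i Hi. rewrite H2; auto. Qed.

Lemma cyl_mono w v s t : (s <= t)%nat -> cyl w t v -> cyl w s v.
Proof. intros L H i Hi. apply H. lia. Qed.

Lemma cyl_eq v w t : cyl w t v -> cyl v t = cyl w t.
Proof.
  intro H. apply set_ext; intro u; split; intro H'.
  - exact (cyl_trans u v w t H H').
  - exact (cyl_trans u w v t (cyl_sym _ _ _ H) H').
Qed.

Lemma cyl0 w : cyl w 0 = setT.
Proof. apply set_ext; intro v; split; [constructor | intros _ i Hi; lia]. Qed.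

Lemma cyl_upd w t b : cyl w t (upd w t b).
Proof. intros i Hi. unfold upd. destruct Nat.eq_dec; [lia | reflexivity]. Qed.

Lemma cyl_upd_iff w t b v : cyl (upd w t b) (S t) v <-> cyl w t v /\ v t = b.
Proof.
  split.
  - intro H; split.
    + intros i Hi. rewrite H by lia. apply cyl_upd, Hi.
    + rewrite H by lia. unfold upd. destruct Nat.eq_dec; [reflexivity | lia].
  - intros [H e] i Hi. unfold upd. destruct Nat.eq_dec as [->|N]; auto.
    apply H. lia.
Qed.

Lemma cyl_split w t :
  cyl w t = setU (cyl (upd w t false) (S t)) (cyl (upd w t true) (S t)).
Proof.
  apply set_ext; intro v. unfold setU. rewrite !cyl_upd_iff.
  destruct (v t); intuition discriminate.
Qed.

Lemma cyl_upd_disjoint w t :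
  disjoint (cyl (upd w t false) (S t)) (cyl (upd w t true) (S t)).
Proof. intro v. rewrite !cyl_upd_iff. intuition congruence. Qed.

Lemma cyl_trunc w t : cyl w t (trunc w t).
Proof. intros i Hi. unfold trunc. destruct lt_dec; [reflexivity | lia]. Qed.

Lemma trunc_cyl w v t : cyl w t v -> trunc v t = trunc w t.
Proof.
  intro H. apply functional_extensionality; intro i. unfold trunc.
  destruct lt_dec; auto.
Qed.

Lemma trunc_S w t : trunc w (S t) = upd (trunc w t) t (w t).
Proof.
  apply functional_extensionality; intro i. unfold trunc, upd.
  destruct (lt_dec i (S t)), (Nat.eq_dec i t), (lt_dec i t); subst; auto; lia.
Qed.

Lemma dep_iff t F v w : dep t F -> cyl w t v -> F v <-> F w.
Proof. intros D H; split; apply D; auto using cyl_sym. Qed.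

Lemma dep_mono s t F : (s <= t)%nat -> dep s F -> dep t F.
Proof. intros L D v w H. apply D. exact (cyl_mono w v s t L H). Qed.

Lemma dep_C t F : dep t F -> dep t (setC F).
Proof. intros D v w H N HF. apply N. apply (D w v); auto using cyl_sym. Qed.

Lemma dep_U t F G : dep t F -> dep t G -> dep t (setU F G).
Proof.
  intros D1 D2 v w H [HF|HG]; [left; apply (D1 v) | right; apply (D2 v)]; assumption.
Qed.

Lemma dep_cyl w t : dep t (cyl w t).
Proof. intros v u H H'. exact (cyl_trans u v w t H' (cyl_sym _ _ _ H)). Qed.

Lemma dep_T : dep 0 setT.
Proof. intros v w _ _. exact I. Qed.

(** * The fair-coin measure on clopen sets *)

Definition ind (F : set) (c : R) (w : Omega) : R :=
  if excluded_middle_informative (F w) then c else 0.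

(* Meaningful only when [dep t F]. *)
Definition coin (t : nat) (F : set) : R := sumw t (ind F ((/ 2) ^ t)).

Lemma ind_iff F G c v w : (F v <-> G w) -> ind F c v = ind G c w.
Proof. unfold ind. intro H. do 2 destruct excluded_middle_informative; tauto. Qed.

Lemma coin_S t F : dep t F -> coin (S t) F = coin t F.
Proof.
  intro D. unfold coin; simpl. apply sumw_ext; intro w.
  rewrite !(ind_iff F F _ (upd w t _) w) by (apply (dep_iff t); auto using cyl_upd).
  unfold ind. destruct excluded_middle_informative; field.
Qed.

Lemma coin_mono s t F : dep s F -> (s <= t)%nat -> coin t F = coin s F.
Proof.
  intros D L. induction L; auto. rewrite coin_S, IHL; auto.
  exact (dep_mono s m F L D).
Qed.

Lemma coin_ge0 t F : 0 <= coin t F.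
Proof.
  unfold coin. replace 0 with (sumw t (fun _ => 0 * 0)).
  - apply sumw_le. intro w. unfold ind. destruct excluded_middle_informative; [|lra].
    pose proof (pow_le (/ 2) t). lra.
  - rewrite sumw_scal. ring.
Qed.

Lemma coin_T : coin 0 setT = 1.
Proof.
  unfold coin; simpl. unfold ind. destruct excluded_middle_informative as [|N]; auto.
  exfalso; apply N; exact I.
Qed.

Lemma coin_U t F G : disjoint F G -> coin t (setU F G) = coin t F + coin t G.
Proof.
  intro D. unfold coin. rewrite <- sumw_add. apply sumw_ext; intro w.
  specialize (D w). unfold ind, setU.
  do 3 destruct excluded_middle_informative; try tauto; lra.
Qed.

Lemma coin_cyl w t : coin t (cyl w t) = (/ 2) ^ t.
Proof.
  (* The weight is generalised to [c] because [(/ 2) ^ t] changes with [t] and would block the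
     induction. *)
  assert (H : forall c, sumw t (ind (cyl w t) c) = c); [|apply H].
  induction t; simpl; intro c.
  - rewrite cyl0. unfold ind, setT. destruct excluded_middle_informative; tauto.
  - transitivity (sumw t (ind (cyl w t) c)); [|apply IHt]. apply sumw_ext; intro v. unfold ind.
    assert (E : forall b, cyl w (S t) (upd v t b) <-> cyl w t v /\ b = w t).
    { intro b. split.
      - intro H. apply cyl_sym in H. apply cyl_upd_iff in H.
        destruct H; auto using cyl_sym.
      - intros [H e]. apply cyl_sym, cyl_upd_iff. auto using cyl_sym. }
    destruct (E false) as [E1 E2], (E true) as [E3 E4].
    destruct (w t);
    repeat destruct excluded_middle_informative; try lra; intuition discriminate.
Qed.

(** * The fair coin modulo the ideal *)

Section CoinModIdeal.

Context (I : set -> Prop) (HI : strictly_proper_ideal I).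

(* [strictly_proper_ideal] allows [I] to be empty, so the empty set is added. *)
Definition null (S : set) : Prop := I S \/ S = set0.

Lemma null_sub S R0 : null S -> subset R0 S -> null R0.
Proof.
  intros [H | ->] HS.
  - left. exact (proj1 HI S R0 H HS).
  - right. set_tac.
Qed.

Lemma null_U S R0 : null S -> null R0 -> null (setU S R0).
Proof.
  intros [H | ->] [H' | ->].
  - left. apply HI; assumption.
  - left. replace (setU S set0) with S by set_tac. assumption.
  - left. replace (setU set0 R0) with R0 by set_tac. assumption.
  - right. set_tac.
Qed.

(** A nonempty clopen set contains a cylinder, and strict properness keeps cylinders out of the
    ideal. *)
Lemma null_dep t F : dep t F -> null F -> F = set0.
Proof.
  intros D N. apply set_ext; intro w; split; [|intros []]. intro Hw. exfalso.
  assert (H : null (cyl w t)).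
  { apply (null_sub F); auto. intros v Hv. apply (D w); auto using cyl_sym. }
  destruct H as [H | H].
  - exact (proj2 (proj2 HI) w t H).
  - change (set0 w). rewrite <- H. apply cyl_refl.
Qed.

Definition clopen_mod (E : set) : Prop :=
  exists t F, dep t F /\ null (symdiff E F).

Definition coin_val (E : set) (r : R) : Prop :=
  exists t F, dep t F /\ null (symdiff E F) /\ r = coin t F.

(** Two clopen representatives of [E] differ by a clopen null set, which is empty by [null_dep]. *)
Lemma coin_val_unique E r s : coin_val E r -> coin_val E s -> r = s.
Proof.
  intros (t & F & HF & NF & ->) (u & G & HG & NG & ->).
  assert (e : F = G).
  { assert (S0 : symdiff F G = set0).
    { apply (null_dep (max t u)).
      - assert (dep (max t u) F) by (apply (dep_mono t); auto; lia).
        assert (dep (max t u) G) by (apply (dep_mono u); auto; lia).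
        replace (symdiff F G)
          with (setU (setC (setU (setC F) G)) (setC (setU (setC G) F))) by set_tac.
        auto using dep_U, dep_C.
      - apply (null_sub (setU (symdiff E F) (symdiff E G))); [|set_tac].
        apply null_U; assumption. }
    apply set_ext; intro w.
    assert (H : ~ symdiff F G w) by (rewrite S0; intros []).
    at_point w. }
  subst G.
  rewrite <- (coin_mono t (max t u) F), <- (coin_mono u (max t u) F); auto; lia.
Qed.

Definition coin_mod (E : set) : R := epsilon (inhabits 0) (coin_val E).

Lemma coin_modE t E F : dep t F -> null (symdiff E F) -> coin_mod E = coin t F.
Proof.
  intros D N. assert (H : coin_val E (coin t F)) by (exists t, F; auto).
  apply (coin_val_unique E); auto. unfold coin_mod. apply epsilon_spec. eauto.
Qed.

Lemma null_symdiff_refl E : null (symdiff E E).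
Proof. right. set_tac. Qed.

Lemma clopen_mod_dep t F : dep t F -> clopen_mod F.
Proof. intro D. exists t, F. auto using null_symdiff_refl. Qed.

Lemma clopen_mod_null S : null S -> clopen_mod S.
Proof.
  intro N. exists O, (setC setT). split; [apply dep_C, dep_T|].
  apply (null_sub S); auto. set_tac.
Qed.

Lemma clopen_mod_algebra : is_algebra clopen_mod.
Proof.
  split; [|split].
  - exact (clopen_mod_dep 0 setT dep_T).
  - intros A (t & F & D & N). exists t, (setC F). split; auto using dep_C.
    apply (null_sub _ _ N). set_tac.
  - intros A1 A2 (t & F & D & N) (u & G & D' & N').
    exists (max t u), (setU F G). split.
    + apply dep_U; [apply (dep_mono t) | apply (dep_mono u)]; auto; lia.
    + apply (null_sub _ _ (null_U _ _ N N')). set_tac.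
Qed.

Lemma coin_mod_fap : is_FAP clopen_mod coin_mod.
Proof.
  split; [|split].
  - intros E (t & F & D & N). rewrite (coin_modE t E F) by auto. apply coin_ge0.
  - rewrite (coin_modE 0 setT setT) by auto using dep_T, null_symdiff_refl.
    exact coin_T.
  - intros A1 A2 (t & F & D & N) (u & G & D' & N') H.
    assert (DF : dep (max t u) F) by (apply (dep_mono t); auto; lia).
    assert (DG : dep (max t u) G) by (apply (dep_mono u); auto; lia).
    rewrite (coin_modE _ A1 F), (coin_modE _ A2 G) by eassumption.
    rewrite (coin_modE (max t u) (setU A1 A2) (setU F G)).
    + apply coin_U.
      (* The representatives of disjoint sets meet in a clopen null set, so they are themselves
         disjoint. *)
      assert (S0 : setC (setU (setC F) (setC G)) = set0).
      { apply (null_dep (max t u)); auto using dep_U, dep_C.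
        apply (null_sub _ _ (null_U _ _ N N')). set_tac. }
      intros w Hf Hg. change (set0 w). rewrite <- S0. at_point w.
    + auto using dep_U.
    + apply (null_sub _ _ (null_U _ _ N N')). set_tac.
Qed.

Theorem coin_extension : exists P,
  is_FAP (fun _ => True) P /\
  (forall w t, P (cyl w t) = (/ 2) ^ t) /\
  (forall E, I E -> P E = 0) /\
  (forall E eps, eps > 0 -> exists t F, dep t F /\ P (symdiff E F) < eps).
Proof.
  destruct (dense_extension clopen_mod clopen_mod_algebra coin_mod coin_mod_fap)
    as (P & HP & He & Hd).
  assert (PN : forall E, null E -> P E = 0).
  { intros E N. rewrite (He E (clopen_mod_null E N)).
    rewrite (coin_modE 0 E set0).
    - pose proof (coin_U 0 set0 set0 ltac:(set_tac)) as H.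
      replace (setU set0 set0) with set0 in H by set_tac. lra.
    - replace set0 with (setC setT) by set_tac. apply dep_C, dep_T.
    - apply (null_sub _ _ N). set_tac. }
  exists P. split; [|split; [|split]]; auto.
  - intros w t. rewrite (He _ (clopen_mod_dep t _ (dep_cyl w t))).
    rewrite (coin_modE t _ (cyl w t)) by auto using dep_cyl, null_symdiff_refl.
    apply coin_cyl.
  - intros E HE. apply PN. left. assumption.
  - intros E eps Heps. destruct (Hd E eps Heps) as (G & (t & F & D & N) & L).
    exists t, F. split; auto.
    (* [G] differs from the clopen set [F] by a null set, which has [P]-measure 0, so [F]
       approximates [E] as well as [G] does. *)
    pose proof (fap_symdiff_trans _ all_sets_algebra P HP E G F
      Logic.I Logic.I Logic.I).
    rewrite (PN _ N) in H. lra.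
Qed.

End CoinModIdeal.

(** * Strong nonatomicity by bisection *)

Section Bisection.

Context (Sigma : set -> Prop) (HS : is_sigma_algebra Sigma)
  (Hcyl : contains_cylinders Sigma).
Context (P : set -> R) (HP : is_FAP Sigma P)
  (Psmall : forall w t, P (cyl w t) = (/ 2) ^ t).
Context (E : set) (HE : Sigma E) (c : R) (Hc : 0 <= c <= P E).

Let HA : is_algebra Sigma := sigma_algebra_algebra Sigma HS.

(** Lexicographic search for the point where the accumulated mass of [E] reaches [c]: the pair holds
    the part of [E] before the current cylinder, and a path naming that cylinder. *)
Definition bisect_step (t : nat) (x : set * Omega) : set * Omega :=
  let (F, w) := x in
  let C := setI E (cyl (upd w t false) (S t)) in
  if Rle_dec c (P F + P C) then (F, upd w t false) else (setU F C, upd w t true).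

Fixpoint bisect (t : nat) : set * Omega :=
  match t with
  | O => (set0, zeros)
  | S t => bisect_step t (bisect t)
  end.

Definition below (t : nat) : set := fst (bisect t).
Definition cell (t : nat) : set := cyl (snd (bisect t)) t.

Lemma bisect_inv t :
  Sigma (below t) /\ subset (below t) E /\ disjoint (below t) (cell t) /\
  P (below t) <= c <= P (below t) + P (setI E (cell t)).
Proof.
  induction t as [|t IH].
  - unfold below, cell; simpl. rewrite cyl0, (fap0 Sigma HA P HP).
    replace (setI E setT) with E by set_tac.
    split; [apply alg0; auto|]. split; [set_tac|]. split; [set_tac | lra].
  - unfold below, cell in *; simpl. destruct (bisect t) as [F w]; simpl in *.
    destruct IH as (HF & SF & DF & L).
    rewrite cyl_split in DF, L. pose proof (cyl_upd_disjoint w t) as D.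
    pose proof (Hcyl (upd w t false) (S t)) as H0.
    pose proof (Hcyl (upd w t true) (S t)) as H1.
    set (C0 := cyl (upd w t false) (S t)) in *.
    set (C1 := cyl (upd w t true) (S t)) in *.
    destruct Rle_dec as [Hle | Hgt]; simpl; fold C0 C1.
    + split; [assumption|]. split; [assumption|]. split; [set_tac | lra].
    + replace (setI E (setU C0 C1)) with (setU (setI E C0) (setI E C1)) in L by set_tac.
      rewrite (fapU Sigma P HP) in L; [|apply algI; assumption..|set_tac].
      rewrite (fapU Sigma P HP); [|try apply algI; assumption..|set_tac].
      split; [apply algU; try apply algI; assumption|].
      split; [set_tac|]. split; [set_tac | lra].
Qed.

Lemma below_incr s t : (s <= t)%nat -> subset (below s) (below t).
Proof.
  intro L; induction L as [|t L IH]; [set_tac|].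
  assert (subset (below t) (below (S t))); [|set_tac].
  unfold below; simpl. destruct (bisect t) as [F w]; simpl.
  destruct Rle_dec; simpl; set_tac.
Qed.

Lemma below_cell_decr s t : (s <= t)%nat ->
  subset (setU (below t) (cell t)) (setU (below s) (cell s)).
Proof.
  intro L; induction L as [|t L IH]; [set_tac|].
  assert (subset (setU (below (S t)) (cell (S t))) (setU (below t) (cell t)));
    [|set_tac].
  clear. unfold below, cell; simpl. destruct (bisect t) as [F w]; simpl.
  rewrite (cyl_split w t).
  destruct Rle_dec; simpl; set (C0 := cyl (upd w t false) (S t));
    set (C1 := cyl (upd w t true) (S t)); set_tac.
Qed.

(** Finite additivity gives no continuity along the increasing union of the [below t]. Instead the
    union is squeezed between [below t] and [setU (below t) (cell t)], whose masses differ by at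
    most [(/ 2) ^ t]. *)
Lemma bisect_exact : exists F, Sigma F /\ subset F E /\ P F = c.
Proof.
  set (F := fun w => exists t, below t w).
  assert (HF : Sigma F) by (apply HS; intro t; apply bisect_inv).
  exists F. split; [assumption|]. split.
  - intros w [t Hw]. apply (bisect_inv t), Hw.
  - assert (close : forall t, Rabs (P F - c) <= (/ 2) ^ t).
    { intro t. destruct (bisect_inv t) as (Hb & _ & _ & L).
      assert (HC : Sigma (cell t)) by apply Hcyl.
      assert (P (below t) <= P F).
      { apply (fap_le Sigma HA P HP); auto. intros w Hw. exists t; assumption. }
      assert (P F <= P (setU (below t) (cell t))).
      { apply (fap_le Sigma HA P HP); [assumption | apply algU; assumption |].
        intros w [s Hw]. destruct (Nat.le_ge_cases s t) as [l|l].
        - left. exact (below_incr s t l w Hw).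
        - apply (below_cell_decr t s l). left; assumption. }
      pose proof (fap_leU Sigma HA P HP _ _ Hb HC).
      assert (P (setI E (cell t)) <= P (cell t)).
      { apply (fap_le Sigma HA P HP); [apply algI; assumption | assumption | set_tac]. }
      assert (P (cell t) = (/ 2) ^ t) by apply Psmall.
      apply Rabs_le. lra. }
    apply NNPP; intro N.
    destruct (pow_lt_1_zero (/ 2) ltac:(rewrite Rabs_right; lra) (Rabs (P F - c)))
      as [t Ht]; [apply Rabs_pos_lt; lra|].
    specialize (Ht t (le_n t)). specialize (close t).
    pose proof (Rle_abs ((/ 2) ^ t)). lra.
Qed.

End Bisection.

Lemma half_pow_cyl_nonatomic (Sigma : set -> Prop) (P : set -> R) :
  is_sigma_algebra Sigma -> contains_cylinders Sigma -> is_FAP Sigma P ->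
  (forall w t, P (cyl w t) = (/ 2) ^ t) ->
  strongly_nonatomic Sigma P.
Proof.
  intros HS Hcyl HP Psmall E alpha HE Ha.
  apply bisect_exact; auto.
  pose proof (fap_ge0 Sigma P HP E HE). nra.
Qed.

(** * Inequalities for the kernel [x * y / (x + y)] *)

Lemma Rle_div_l x y z : 0 < y -> x <= z * y -> x / y <= z.
Proof.
  intros Hy H. apply (Rmult_le_reg_r y); [assumption|].
  unfold Rdiv. rewrite Rmult_assoc, Rinv_l, Rmult_1_r; lra.
Qed.

Lemma Rle_div_r x y z : 0 < y -> z * y <= x -> z <= x / y.
Proof.
  intros Hy H. apply (Rmult_le_reg_r y); [assumption|].
  unfold Rdiv. rewrite Rmult_assoc, Rinv_l, Rmult_1_r; lra.
Qed.

(* [kernel 0 0 = 0] because the numerator vanishes. *)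
Definition kernel (x y : R) : R := x * y / (x + y).

Lemma kernel_sym x y : kernel x y = kernel y x.
Proof. unfold kernel. rewrite (Rplus_comm y x), (Rmult_comm y x). reflexivity. Qed.

Lemma kernel0 y : kernel 0 y = 0.
Proof. unfold kernel, Rdiv. ring. Qed.

Lemma kernel_ge0 x y : 0 <= x -> 0 <= y -> 0 <= kernel x y.
Proof.
  intros Hx Hy. destruct (Req_dec x 0) as [->|N]; [rewrite kernel0; lra|].
  unfold kernel. apply Rmult_le_pos; [nra|]. left. apply Rinv_0_lt_compat. lra.
Qed.

(** The slope in the first argument is [y ^ 2 / (x + y) ^ 2], which lies between 0 and 1. *)
Lemma kernel_le x y x' e : 0 <= x -> 0 <= y -> 0 <= e -> 0 <= x' -> x' <= x + e ->
  kernel x' y <= kernel x y + e.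
Proof.
  intros Hx Hy He Hx' L.
  destruct (Req_dec x' 0) as [->|N'].
  { rewrite kernel0. pose proof (kernel_ge0 x y Hx Hy). lra. }
  destruct (Req_dec x 0) as [->|N].
  { rewrite kernel0. apply Rle_trans with x'; [|lra].
    unfold kernel. apply Rle_div_l; nra. }
  apply Rminus_le.
  replace (kernel x' y - (kernel x y + e))
    with (((x' - x) * y ^ 2 - e * ((x + y) * (x' + y))) / ((x + y) * (x' + y)))
    by (unfold kernel; field; lra).
  apply Rle_div_l; [nra|].
  rewrite Rmult_0_l.
  assert ((x' - x) * y ^ 2 <= e * y ^ 2) by nra.
  assert (e * y ^ 2 <= e * ((x + y) * (x' + y))); [|lra].
  apply Rmult_le_compat_l; nra.
Qed.

Lemma kernel_lip x y x' y' e f :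
  0 <= x -> 0 <= y -> 0 <= e -> 0 <= f -> 0 <= x' -> 0 <= y' ->
  x' <= x + e -> y' <= y + f -> kernel x' y' <= kernel x y + e + f.
Proof.
  intros. apply Rle_trans with (kernel x y' + e).
  - apply kernel_le; assumption.
  - rewrite (kernel_sym x y'), (kernel_sym x y).
    pose proof (kernel_le y x y' f). lra.
Qed.

(** Outside the degenerate cases the gap equals [(a * d - b * c) ^ 2] divided by
    [(a + c) * (b + d) * (a + b + c + d)], and this divisor is at most the cube of the total. *)
Lemma kernel_gap a b c d : 0 <= a -> 0 <= b -> 0 <= c -> 0 <= d ->
  0 <= kernel (a + b) (c + d) - kernel a c - kernel b d /\
  (a * d - b * c) ^ 2
    <= (kernel (a + b) (c + d) - kernel a c - kernel b d) * (a + b + c + d) ^ 3.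
Proof.
  intros Ha Hb Hc Hd.
  destruct (Req_dec (a + c) 0) as [e|N1].
  { replace a with 0 by lra. replace c with 0 by lra. rewrite kernel0, !Rplus_0_l.
    split; [lra|]. right; ring. }
  destruct (Req_dec (b + d) 0) as [e|N2].
  { replace b with 0 by lra. replace d with 0 by lra. rewrite kernel0, !Rplus_0_r.
    split; [lra|]. right; ring. }
  assert (G : kernel (a + b) (c + d) - kernel a c - kernel b d
    = (a * d - b * c) ^ 2 * / ((a + c) * (b + d) * (a + b + c + d))).
  { unfold kernel. field. lra. }
  assert (0 < (a + c) * (b + d)) by nra.
  assert (0 < / ((a + c) * (b + d) * (a + b + c + d))).
  { apply Rinv_0_lt_compat. nra. }
  rewrite G. split; [apply Rmult_le_pos; [apply pow2_ge_0 | lra]|].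
  replace ((a * d - b * c) ^ 2 * / ((a + c) * (b + d) * (a + b + c + d)) *
    (a + b + c + d) ^ 3) with
    ((a * d - b * c) ^ 2 * ((a + b + c + d) ^ 2 / ((a + c) * (b + d))))
    by (field; lra).
  rewrite <- (Rmult_1_r ((a * d - b * c) ^ 2)) at 1.
  apply Rmult_le_compat_l; [apply pow2_ge_0|].
  apply Rle_div_r; nra.
Qed.

(** In use, [a, b] are the [P]-masses and [c, d] the [Q]-masses of the two pieces of a cylinder. The
    conditionals differ by [(a * d - b * c) / ((a + b) * (c + d))], and the ratio bound [K] makes
    the total mass at most [(K + 1) * (a + b)]. The parameter [theta] turns the quadratic estimate
    into a linear one that can be summed over cylinders. *)
Lemma kernel_gap_cond a b c d K eta theta :
  0 <= a -> 0 <= b -> 0 <= c -> 0 <= d -> 0 < a + b -> 0 < c + d ->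
  0 < K -> c + d <= K * (a + b) -> 0 < eta -> 0 < theta ->
  eta < Rabs (a / (a + b) - c / (c + d)) ->
  eta / (K + 1) * (c + d) <= theta * (a + b + (c + d)) +
    (kernel (a + b) (c + d) - kernel a c - kernel b d) / theta.
Proof.
  intros Ha Hb Hc Hd Hab Hcd HK Hk Heta Hth Hdiff.
  destruct (kernel_gap a b c d Ha Hb Hc Hd) as [G0 G].
  set (g := kernel (a + b) (c + d) - kernel a c - kernel b d) in *.
  set (M := a + b + c + d) in *. assert (HM : 0 < M) by (unfold M; lra).
  set (u := Rabs (a * d - b * c) / M).
  assert (Hu : u ^ 2 <= g * M).
  { unfold u. replace ((Rabs (a * d - b * c) / M) ^ 2)
      with ((Rabs (a * d - b * c)) ^ 2 / M ^ 2) by (field; lra).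
    rewrite pow2_abs. apply Rle_div_l; [nra|].
    replace (g * M * M ^ 2) with (g * M ^ 3) by ring. assumption. }
  assert (L1 : eta * (a + b) * (c + d) < u * M).
  { unfold u. replace (Rabs (a * d - b * c) / M * M) with (Rabs (a * d - b * c))
      by (field; lra).
    replace (a / (a + b) - c / (c + d))
      with ((a * d - b * c) * / ((a + b) * (c + d))) in Hdiff by (field; lra).
    assert (Hp : 0 < (a + b) * (c + d)) by nra.
    rewrite Rabs_mult, (Rabs_right (/ _)) in Hdiff
      by (left; apply Rinv_0_lt_compat; assumption).
    apply (Rmult_lt_compat_r ((a + b) * (c + d))) in Hdiff; [|assumption].
    rewrite Rmult_assoc, Rinv_l in Hdiff by lra. lra. }
  assert (L2 : eta / (K + 1) * (c + d) <= u).
  { apply (Rmult_le_reg_r M); [assumption|].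
    apply Rle_trans with (eta * (a + b) * (c + d)); [|lra].
    assert (M <= (K + 1) * (a + b)) by (unfold M; lra).
    replace (eta * (a + b) * (c + d))
      with (eta / (K + 1) * (c + d) * ((K + 1) * (a + b))) by (field; lra).
    apply Rmult_le_compat_l; [|assumption].
    apply Rmult_le_pos; [|lra]. left. apply Rdiv_lt_0_compat; lra. }
  apply Rle_trans with (1 := L2).
  replace (a + b + (c + d)) with M by (unfold M; ring).
  assert (0 <= u) by (unfold u; apply Rmult_le_pos;
    [apply Rabs_pos | left; apply Rinv_0_lt_compat; assumption]).
  (* AM-GM: [2 u <= theta M + u^2 / (theta M)]. *)
  apply (Rmult_le_reg_r (theta * M)); [nra|].
  replace ((theta * M + g / theta) * (theta * M)) with ((theta * M) ^ 2 + g * M)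
    by (field; lra).
  pose proof (pow2_ge_0 (theta * M - u)).
  assert (0 <= u * (theta * M)) by (apply Rmult_le_pos; nra).
  nra.
Qed.

(** * Gluing events over cylinders, and total mass as a sum *)

Section Measurability.

Context (Sigma : set -> Prop) (HA : is_algebra Sigma) (Hcyl : contains_cylinders Sigma).

Lemma glue_measurable t : forall A : Omega -> set,
  (forall w, Sigma (setI (cyl w t) (A w))) -> Sigma (fun v => A (trunc v t) v).
Proof.
  induction t as [|t IH]; intros A H.
  - replace (fun v => A (trunc v 0) v) with (setI (cyl zeros 0) (A zeros)); auto.
    apply set_ext; intro v. rewrite cyl0.
    rewrite (trunc_cyl zeros v 0) by (rewrite cyl0; exact I).
    replace (trunc zeros 0) with zeros.
    + split; [intros [_ Hv]; assumption | intro Hv; split; [exact I | assumption]].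
    + apply functional_extensionality; intro i. unfold trunc.
      destruct lt_dec; reflexivity.
  (* The coordinate [t] is moved into the family, so that gluing at time [S t] becomes gluing at
     time [t]. *)
  - replace (fun v => A (trunc v (S t)) v)
      with (fun v => (fun w v => A (upd w t (v t)) v) (trunc v t) v)
      by (apply functional_extensionality; intro v; rewrite trunc_S; reflexivity).
    apply (IH (fun w v => A (upd w t (v t)) v)). intro w.
    replace (setI (cyl w t) (fun v => A (upd w t (v t)) v)) with
      (setU (setI (cyl (upd w t false) (S t)) (A (upd w t false)))
            (setI (cyl (upd w t true) (S t)) (A (upd w t true)))).
    + apply algU; auto.
    + apply set_ext; intro v. unfold setU, setI. rewrite !cyl_upd_iff.
      destruct (v t); intuition discriminate.
Qed.

Lemma dep_measurable t F : dep t F -> Sigma F.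
Proof.
  intro D. replace F with (fun v => F (trunc v t)).
  - apply (glue_measurable t (fun w _ => F w)). intro w.
    destruct (classic (F w)) as [Hw | Hw].
    + replace (setI (cyl w t) (fun _ => F w)) with (cyl w t); auto.
      apply set_ext; intro v; unfold setI; tauto.
    + replace (setI (cyl w t) (fun _ => F w)) with set0; [apply alg0, HA|].
      apply set_ext; intro v; unfold setI, set0; tauto.
  - apply set_ext; intro v. split; apply D; auto using cyl_trunc, cyl_sym.
Qed.

Context (mu : set -> R) (Hmu : is_FAP Sigma mu).

Lemma fap_cyl_split w t A : Sigma A ->
  mu (setI A (cyl w t)) = mu (setI A (cyl (upd w t false) (S t)))
    + mu (setI A (cyl (upd w t true) (S t))).
Proof.
  intro H. rewrite <- (fapU Sigma mu Hmu); try (apply (algI Sigma HA); auto).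
  - rewrite cyl_split. f_equal. set (C0 := cyl (upd w t false) (S t)).
    set (C1 := cyl (upd w t true) (S t)). set_tac.
  - intros v [_ H0] [_ H1]. exact (cyl_upd_disjoint w t v H0 H1).
Qed.

Lemma fap_sum t A : Sigma A -> sumw t (fun w => mu (setI A (cyl w t))) = mu A.
Proof.
  intro H. induction t; simpl.
  - rewrite cyl0. replace (setI A setT) with A by set_tac. reflexivity.
  - rewrite <- IHt. apply sumw_ext; intro w. symmetry; auto using fap_cyl_split.
Qed.

Lemma fap_sum_cyl t : sumw t (fun w => mu (cyl w t)) = 1.
Proof.
  rewrite <- (fapT Sigma mu Hmu), <- (fap_sum t setT) by apply (algT _ HA).
  apply sumw_ext; intro w. f_equal. set (C := cyl w t). set_tac.
Qed.

End Measurability.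

(** * Merging for probabilities with dense clopen sets *)

Section Merging.

Context (Sigma : set -> Prop) (HA : is_algebra Sigma) (Hcyl : contains_cylinders Sigma).
Context (P : set -> R) (HP : is_FAP Sigma P).
Context (Ppos : forall w t, 0 < P (cyl w t)).
Context (Pdense : forall E eps, Sigma E -> eps > 0 ->
  exists t F, dep t F /\ P (symdiff E F) < eps).
Context (Q : set -> R) (HQ : is_FAP Sigma Q) (HQP : abs_cont Sigma Q P).

(** If every [delta] failed, choosing a failure for each threshold [/ INR (S n)] would give a
    sequence contradicting [abs_cont]. *)
Lemma abs_cont_eps eps : eps > 0 ->
  exists delta, delta > 0 /\ forall E, Sigma E -> P E < delta -> Q E < eps.
Proof.
  intro Heps. apply NNPP; intro N.
  assert (H : forall n : nat, exists E, Sigma E /\ P E < / INR (S n) /\ eps <= Q E).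
  { intro n. apply NNPP; intro N'. apply N. exists (/ INR (S n)). split.
    - apply Rinv_0_lt_compat, lt_0_INR. lia.
    - intros E HE L. apply Rnot_le_lt; intro L'. apply N'. eauto. }
  destruct (choice _ H) as [E HE].
  destruct (HQP E) with (eps := eps) as [n0 Hn]; auto.
  - intro n; apply HE.
  - intros e He. destruct (archimed_cor1 e He) as (n0 & L0 & Hn0).
    exists n0. intros n Hn. unfold R_dist. rewrite Rminus_0_r, Rabs_right.
    + destruct (HE n) as (_ & L & _). apply Rlt_trans with (1 := L).
      apply Rle_lt_trans with (2 := L0). apply Rinv_le_contravar.
      * apply lt_0_INR; lia.
      * apply le_INR; lia.
    + apply Rle_ge, (fap_ge0 Sigma P HP), HE.
  - specialize (Hn n0 (le_n n0)). destruct (HE n0) as (H1 & _ & H2).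
    unfold R_dist in Hn. rewrite Rminus_0_r in Hn.
    pose proof (Rle_abs (Q (E n0))). lra.
Qed.

Definition phi (A : set) : R := kernel (P A) (Q A).

Lemma phi_ge0 A : Sigma A -> 0 <= phi A.
Proof.
  intro H. apply kernel_ge0;
    [apply (fap_ge0 Sigma P HP) | apply (fap_ge0 Sigma Q HQ)]; assumption.
Qed.

Lemma phi0 : phi set0 = 0.
Proof. unfold phi. rewrite (fap0 Sigma HA P HP). apply kernel0. Qed.

Lemma phi_super A B : Sigma A -> Sigma B -> disjoint A B ->
  phi A + phi B <= phi (setU A B).
Proof.
  intros H1 H2 D. unfold phi.
  rewrite (fapU Sigma P HP), (fapU Sigma Q HQ) by assumption.
  destruct (kernel_gap (P A) (P B) (Q A) (Q B)) as [H _];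
    try (apply (fap_ge0 Sigma P HP) || apply (fap_ge0 Sigma Q HQ); assumption).
  lra.
Qed.

Lemma phi_lip A B D : Sigma A -> Sigma B -> Sigma D -> subset A (setU B D) ->
  phi A <= phi B + (P D + Q D).
Proof.
  intros H1 H2 H3 S. unfold phi. rewrite <- Rplus_assoc.
  apply kernel_lip;
    try (apply (fap_ge0 Sigma P HP) || apply (fap_ge0 Sigma Q HQ); assumption).
  - eapply Rle_trans; [|apply (fap_leU Sigma HA P HP); assumption].
    apply (fap_le Sigma HA P HP); auto. apply algU; auto.
  - eapply Rle_trans; [|apply (fap_leU Sigma HA Q HQ); assumption].
    apply (fap_le Sigma HA Q HQ); auto. apply algU; auto.
Qed.

(** * The potential and its uniform drop *)

Definition pot (t : nat) : R := sumw t (fun w => phi (cyl w t)).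

Definition pot_split (E : set) (t : nat) : R :=
  sumw t (fun w => phi (setI E (cyl w t)) + phi (setD (cyl w t) E)).

Lemma pot_decr t : pot (S t) <= pot t.
Proof.
  unfold pot; simpl. apply sumw_le; intro w. rewrite (cyl_split w t).
  apply phi_super; auto using cyl_upd_disjoint.
Qed.

Lemma pot_split_decr E s t : Sigma E -> (s <= t)%nat -> pot_split E t <= pot_split E s.
Proof.
  intros HE L. induction L as [|t L IH]; [lra|].
  apply Rle_trans with (2 := IH).
  unfold pot_split; simpl. apply sumw_le; intro w. rewrite (cyl_split w t).
  pose proof (cyl_upd_disjoint w t) as D.
  assert (H0 : Sigma (cyl (upd w t false) (S t))) by apply Hcyl.
  assert (H1 : Sigma (cyl (upd w t true) (S t))) by apply Hcyl.
  set (C0 := cyl (upd w t false) (S t)) in *.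
  set (C1 := cyl (upd w t true) (S t)) in *. clearbody C0 C1.
  assert (L1 : phi (setI E C0) + phi (setI E C1) <= phi (setI E (setU C0 C1))).
  { replace (setI E (setU C0 C1)) with (setU (setI E C0) (setI E C1)) by set_tac.
    apply phi_super; [apply algI; auto..|set_tac]. }
  assert (L2 : phi (setD C0 E) + phi (setD C1 E) <= phi (setD (setU C0 C1) E)).
  { replace (setD (setU C0 C1) E) with (setU (setD C0 E) (setD C1 E)) by set_tac.
    apply phi_super; [apply algD; auto..|set_tac]. }
  lra.
Qed.

(** Each cylinder of length [t] lies inside [F] or misses it, so one of its two pieces is empty. *)
Lemma pot_split_dep t F : dep t F -> pot_split F t = pot t.
Proof.
  intro D. unfold pot_split, pot. apply sumw_ext; intro w.
  destruct (classic (F w)) as [Hw | Hw].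
  - assert (S : subset (cyl w t) F).
    { intros v Hv. apply (D w v); auto using cyl_sym. }
    set (C := cyl w t) in *. clearbody C.
    replace (setI F C) with C by set_tac.
    replace (setD C F) with set0 by set_tac. rewrite phi0. ring.
  - assert (S : disjoint (cyl w t) F).
    { intros v Hv Hf. apply Hw. apply (D v w); auto. }
    set (C := cyl w t) in *. clearbody C.
    replace (setI F C) with set0 by set_tac.
    replace (setD C F) with C by set_tac. rewrite phi0. ring.
Qed.

(** The factor 2 arises because both pieces of a cylinder change by at most its share of the
    symmetric difference. *)
Lemma pot_split_lip E F t : Sigma E -> Sigma F ->
  pot_split F t <= pot_split E t + 2 * (P (symdiff E F) + Q (symdiff E F)).
Proof.
  intros HE HF.
  assert (HD : Sigma (symdiff E F)) by (apply alg_symdiff; auto).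
  rewrite <- (fap_sum Sigma HA Hcyl P HP t (symdiff E F)) by assumption.
  rewrite <- (fap_sum Sigma HA Hcyl Q HQ t (symdiff E F)) by assumption.
  unfold pot_split. rewrite <- sumw_add, <- sumw_scal, <- sumw_add.
  apply sumw_le; intro w. assert (HC := Hcyl w t).
  set (C := cyl w t) in *. clearbody C.
  assert (HDC : Sigma (setI (symdiff E F) C)) by (apply algI; auto).
  assert (phi (setI F C) <= phi (setI E C)
    + (P (setI (symdiff E F) C) + Q (setI (symdiff E F) C))).
  { apply phi_lip; [apply algI; auto..|assumption|set_tac]. }
  assert (phi (setD C F) <= phi (setD C E)
    + (P (setI (symdiff E F) C) + Q (setI (symdiff E F) C))).
  { apply phi_lip; [apply algD; auto..|assumption|set_tac]. }
  lra.
Qed.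

(* Any event is almost clopen, so splitting along it lowers the potential no
   more than refining to some later time does. *)
Lemma pot_split_lower E t l : Sigma E -> (forall s, l <= pot s) -> l <= pot_split E t.
Proof.
  intros HE Hl. apply le_epsilon; intros eps Heps.
  (* Both [P] and [Q] of the symmetric difference fall below [eps / 4], so the bound of
     [pot_split_lip] stays below [eps]. *)
  destruct (abs_cont_eps (eps / 4) ltac:(lra)) as (delta & Hd & Hac).
  destruct (Pdense E (Rmin delta (eps / 4)) HE) as (s & F & D & L).
  { apply Rmin_glb_lt; lra. }
  assert (HF : Sigma F) by exact (dep_measurable Sigma HA Hcyl s F D).
  assert (P (symdiff E F) < eps / 4) by (eapply Rlt_le_trans; [exact L | apply Rmin_r]).
  assert (Q (symdiff E F) < eps / 4).
  { apply Hac; [apply alg_symdiff; auto|]. eapply Rlt_le_trans; [exact L | apply Rmin_l]. }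
  specialize (Hl (max s t)).
  rewrite <- (pot_split_dep (max s t) F) in Hl by (apply (dep_mono s); auto; lia).
  pose proof (pot_split_decr F t (max s t) HF ltac:(lia)).
  pose proof (pot_split_lip E F t HE HF). lra.
Qed.

(** With [l] the limit of [pot], every [pot_split E t] is at least [l], while [pot t] is within
    [delta] of [l] from some [T] on; thus [T] does not depend on [E]. *)
Lemma pot_gap delta : delta > 0 ->
  exists T, forall t E, (T <= t)%nat -> Sigma E -> pot t - pot_split E t <= delta.
Proof.
  intro Hdelta.
  assert (Hdec : Un_decreasing pot) by (intro t; apply pot_decr).
  destruct (decreasing_cv pot Hdec) as [l Hl].
  { exists 0. intros x [t ->]. unfold opp_seq.
    assert (0 <= pot t); [|lra]. unfold pot.
    replace 0 with (sumw t (fun _ => 0 * 0)) by (rewrite sumw_scal; ring).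
    apply sumw_le; intro w. rewrite Rmult_0_l. apply phi_ge0, Hcyl. }
  destruct (Hl delta Hdelta) as [T HT]. exists T. intros t E Ht HE.
  specialize (HT t Ht). unfold R_dist in HT. apply Rabs_def2 in HT.
  pose proof (pot_split_lower E t l HE (decreasing_ineq pot l Hdec Hl)). lra.
Qed.

(** * Bounding the bad cylinders *)

Lemma bad_set_dep eta t : dep t (bad_set Sigma P Q eta t).
Proof.
  intros v w H. unfold bad_set, cond. rewrite (cyl_eq v w t H). auto.
Qed.

Definition ratio_above (K : R) (t : nat) : set :=
  fun w => K * P (cyl w t) < Q (cyl w t).

Lemma ratio_above_dep K t : dep t (ratio_above K t).
Proof. intros v w H. unfold ratio_above. rewrite (cyl_eq v w t H). auto. Qed.

(** Markov's inequality for the ratio of [Q] to [P] on cylinders. *)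
Lemma ratio_above_small K t : 0 <= K -> K * P (ratio_above K t) <= 1.
Proof.
  intro HK. assert (D := ratio_above_dep K t).
  assert (HL := dep_measurable Sigma HA Hcyl t _ D).
  rewrite <- (fap_sum Sigma HA Hcyl P HP t) by assumption.
  rewrite <- (fap_sum_cyl Sigma HA Hcyl Q HQ t), <- sumw_scal.
  apply sumw_le; intro w. assert (HC := Hcyl w t).
  destruct (classic (ratio_above K t w)) as [Hw | Hw].
  - apply Rle_trans with (K * P (cyl w t)).
    + apply Rmult_le_compat_l; [assumption|]. apply (fap_le Sigma HA P HP); auto.
      * apply algI; auto.
      * intros v [_ Hv]; assumption.
    + unfold ratio_above in Hw. lra.
  - replace (setI (ratio_above K t) (cyl w t)) with set0.
    + rewrite (fap0 Sigma HA P HP), Rmult_0_r. apply (fap_ge0 Sigma Q HQ); auto.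
    + apply set_ext; intro v; split; [intros []|]. intros [Hv Hc].
      apply Hw, (D v w); assumption.
Qed.

(** One witness event per bad cylinder is glued into a single [E], and [kernel_gap_cond] is summed
    over cylinders. The total masses of [P] and [Q] contribute [2 * theta], and the drop along [E]
    divided by [theta] contributes the third [theta]. *)
Lemma bad_small K eta theta t : 0 < K -> 0 < eta -> 0 < theta ->
  (forall E, Sigma E -> pot t - pot_split E t <= theta ^ 2) ->
  eta / (K + 1) * Q (setD (bad_set Sigma P Q eta t) (ratio_above K t)) <= 3 * theta.
Proof.
  intros HK Heta Hth Hpot.
  set (B := setD (bad_set Sigma P Q eta t) (ratio_above K t)).
  assert (DB : dep t B).
  { intros v w H [H1 H2]. split; [exact (bad_set_dep eta t v w H H1)|].
    intro H3. apply H2, (ratio_above_dep K t w v); auto using cyl_sym. }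
  assert (HB := dep_measurable Sigma HA Hcyl t B DB).
  destruct (choice (fun w E => Sigma E /\
    (B w -> Rabs (cond P E w t - cond Q E w t) > eta))) as [e He].
  { intro w. destruct (classic (B w)) as [[(_ & [H0 | (_ & E & HE & L)]) _] | N].
    - pose proof (Ppos w t). lra.
    - eauto.
    - exists setT. split; [apply algT; auto | tauto]. }
  set (E := fun v => e (trunc v t) v).
  assert (HE : Sigma E).
  { apply glue_measurable; auto. intro w. apply algI; auto. apply He. }
  assert (L : eta / (K + 1) * Q B <=
    theta * (1 + 1) + (pot t - pot_split E t) / theta).
  { replace (pot t - pot_split E t) with (pot t + -1 * pot_split E t) by ring.
    unfold Rdiv at 2. rewrite (Rmult_comm _ (/ theta)).
    rewrite <- (fap_sum Sigma HA Hcyl Q HQ t B) by assumption.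
    replace (1 + 1) with (sumw t (fun w => P (cyl w t)) + sumw t (fun w => Q (cyl w t)))
      by (rewrite (fap_sum_cyl Sigma HA Hcyl P HP), (fap_sum_cyl Sigma HA Hcyl Q HQ);
          reflexivity).
    unfold pot, pot_split. rewrite <- !sumw_scal, <- !sumw_add, <- !sumw_scal, <- !sumw_add.
    apply sumw_le; intro w. assert (HC := Hcyl w t).
    assert (HEC : Sigma (setI E (cyl w t))) by (apply algI; auto).
    assert (HDC : Sigma (setD (cyl w t) E)) by (apply algD; auto).
    assert (eC : cyl w t = setU (setI E (cyl w t)) (setD (cyl w t) E)).
    { set (C := cyl w t). set_tac. }
    assert (dC : disjoint (setI E (cyl w t)) (setD (cyl w t) E)).
    { set (C := cyl w t). set_tac. }
    pose proof (phi_super _ _ HEC HDC dC) as G. rewrite <- eC in G.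
    pose proof (fapU Sigma P HP _ _ HEC HDC dC) as EP. rewrite <- eC in EP.
    pose proof (fapU Sigma Q HQ _ _ HEC HDC dC) as EQ. rewrite <- eC in EQ.
    pose proof (fap_ge0 Sigma P HP _ HEC). pose proof (fap_ge0 Sigma P HP _ HDC).
    pose proof (fap_ge0 Sigma Q HQ _ HEC). pose proof (fap_ge0 Sigma Q HQ _ HDC).
    destruct (classic (B w)) as [Hw | Hw].
    - replace (setI B (cyl w t)) with (cyl w t).
      + destruct (He (trunc w t)) as [_ Hgap].
        assert (Hw' : B (trunc w t)) 
          by exact (DB w (trunc w t) (cyl_sym _ _ _ (cyl_trunc w t)) Hw).
        specialize (Hgap Hw'). unfold cond in Hgap.
        rewrite (cyl_eq (trunc w t) w t (cyl_trunc w t)) in Hgap.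
        (* On the cylinder of [w] the glued event coincides with the witness chosen for its
           representative. *)
        replace (setI (e (trunc w t)) (cyl w t)) with (setI E (cyl w t)) in Hgap.
        * destruct Hw as [(Qpos & _) Hr]. unfold ratio_above in Hr.
          pose proof (Ppos w t). unfold phi in *. rewrite EP, EQ in *.
          eapply Rle_trans;
            [apply (kernel_gap_cond (P (setI E (cyl w t))) (P (setD (cyl w t) E))
               _ _ K eta theta); try assumption; lra|].
          right. unfold Rdiv. ring.
        * apply set_ext; intro v. unfold setI, E.
          split; intros [H3 H4]; rewrite (trunc_cyl w v t H4) in *; auto.
      + apply set_ext; intro v; split; [|intros [_ Hv]; assumption].
        intro Hv. split; [|assumption]. apply (DB w); auto using cyl_sym.
    (* Off [B] the left side vanishes, and the right side is nonnegative by superadditivity. *)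
    - replace (setI B (cyl w t)) with set0.
      + rewrite (fap0 Sigma HA Q HQ), Rmult_0_r.
        assert (0 <= / theta) by (left; apply Rinv_0_lt_compat; lra).
        apply Rplus_le_le_0_compat; apply Rmult_le_pos; lra.
      + apply set_ext; intro v; split; [intros []|]. intros [Hv Hc].
        apply Hw, (DB v w); assumption. }
  apply Rle_trans with (1 := L).
  assert ((pot t - pot_split E t) / theta <= theta); [|lra].
  apply Rle_div_l; [assumption|]. specialize (Hpot E HE). lra.
Qed.

Theorem dense_merges : merges Sigma P Q.
Proof.
  intros eta Heta eps Heps.
  destruct (abs_cont_eps (eps / 2) ltac:(lra)) as (delta & Hd & Hac).
  (* By Markov's inequality this [K] gives [ratio_above K t] a [P]-mass of at most [delta / 2]. The
     value of [theta] below makes [3 * theta] equal to [eta / (K + 1) * (eps / 4)]. *)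
  set (K := 2 / delta). assert (HK : 0 < K) by (apply Rdiv_lt_0_compat; lra).
  set (theta := eps * eta / (12 * (K + 1))).
  assert (Hth : 0 < theta) by (apply Rdiv_lt_0_compat; nra).
  destruct (pot_gap (theta ^ 2)) as [T HT]; [apply pow_lt; assumption|].
  exists T. intros t Ht.
  set (B := bad_set Sigma P Q eta t).
  assert (HB : Sigma B) by exact (dep_measurable Sigma HA Hcyl t _ (bad_set_dep eta t)).
  assert (HL := dep_measurable Sigma HA Hcyl t _ (ratio_above_dep K t)).
  unfold R_dist. rewrite Rminus_0_r, Rabs_right
    by (apply Rle_ge, (fap_ge0 Sigma Q HQ); assumption).
  assert (L1 : Q (setD B (ratio_above K t)) <= eps / 4).
  { pose proof (bad_small K eta theta t HK Heta Hth (fun E => HT t E Ht)) as L.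
    fold B in L. apply (Rmult_le_reg_l (eta / (K + 1))).
    - apply Rdiv_lt_0_compat; lra.
    - apply Rle_trans with (1 := L). right. unfold theta. field. lra. }
  assert (L2 : Q (ratio_above K t) < eps / 2).
  { apply Hac; [assumption|].
    pose proof (ratio_above_small K t ltac:(lra)) as L.
    apply Rnot_le_lt; intro N.
    assert (K * delta <= K * P (ratio_above K t)) by (apply Rmult_le_compat_l; lra).
    assert (K * delta = 2) by (unfold K; field; lra). lra. }
  assert (L3 : Q B <= Q (setU (setD B (ratio_above K t)) (ratio_above K t))).
  { set (G := ratio_above K t) in *. clearbody B G.
    apply (fap_le Sigma HA Q HQ); [assumption | apply algU; auto; apply algD; auto | set_tac]. }
  pose proof (fap_leU Sigma HA Q HQ _ _ (algD Sigma HA _ _ HB HL) HL). lra.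
Qed.

End Merging.

Theorem theorem4 (Sigma : set -> Prop)
  (HSigma : is_sigma_algebra Sigma) (Hcyl : contains_cylinders Sigma)
  (I : set -> Prop) (HI : strictly_proper_ideal I) :
  exists P : set -> R, in_Delta_BD Sigma P /\
    (forall E, I E -> Sigma E -> P E = 0).
Proof.
  (* [P] is defined on all sets; its additivity and density restrict to [Sigma]. *)
  destruct (coin_extension I HI) as (P & (P0 & P1 & PU) & Pc & PI & Pd).
  assert (HP : is_FAP Sigma P) by (split; [|split]; auto).
  exists P. split; [split; [assumption | split]|].
  - apply half_pow_cyl_nonatomic; assumption.
  - intros Q HQ HQP. apply dense_merges; auto using sigma_algebra_algebra.
    intros w t. rewrite Pc. apply pow_lt. lra.
  - auto.
Qed.
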